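(* Let $[0,1]$ carry the Euclidean metric and let $\mathcal M_{[0,1]}$ be the set of isometry classes of compact metric spaces $Y$ such that $d_L([0,1],Y)<\infty$, where $d_L$ is the Lipschitz distance. Then the metric space $(\mathcal M_{[0,1]},d_L)$ is not separable.
   Context: For compact metric spaces $(X,d_X)$ and $(Y,d_Y)$ and a Lipschitz map $f:X\to Y$, the dilation of $f$ is its smallest Lipschitz constant, $\mathrm{dil}(f)=\sup_{x,y\in X,\, x\neq y}\frac{d_Y(f(x),f(y))}{d_X(x,y)}$. For $\epsilon \ge 0$, a bi-Lipschitz homeomorphism $f:X\to Y$ is called an $\epsilon$-isometry if $|\log \mathrm{dil}(f)|+|\log \mathrm{dil}(f^{-1})|\le \epsilon$. The Lipschitz distance $d_L(X,Y)$ is the infimum of all $\epsilon\ge 0$ such that an $\epsilon$-isometry $f:X\to Y$ exists (with $d_L(X,Y)=\infty$ if there is none). It depends only on the isometry classes of $X$ and $Y$ and is a metric (possibly taking the value $\infty$) on the set of isometry classes of compact metric spaces. *)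

(* Defs.v *)
From HB Require Import structures.
From mathcomp Require Import all_boot all_order all_algebra.
From mathcomp Require Import all_classical all_reals all_analysis.

Set Implicit Arguments.
Unset Strict Implicit.
Unset Printing Implicit Defensive.

Import Order.TTheory GRing.Theory Num.Theory.
Import numFieldNormedType.Exports.

Local Open Scope classical_set_scope.
Local Open Scope ring_scope.

Section subspace_metric.
Context {R : realType} {X : metricType R} (A : set X).

Definition sub_mdist (x y : A) : R := mdist (\val x) (\val y).

Lemma sub_mdist_ge0 x y : 0 <= sub_mdist x y.
Proof. exact: mdist_ge0. Qed.

Lemma sub_mdist_positivity x y : sub_mdist x y = 0 -> x = y.
Proof. by move/mdist_positivity/val_inj. Qed.

Lemma sub_ballEmdist (x : A) (d : R) : ball x d = [set y | sub_mdist x y < d].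
Proof.
rewrite -[LHS]/(@set_val X A @^-1` ball (set_val x) d) ballEmdist.
by rewrite set_valE.
Qed.

HB.instance Definition _ := PseudoMetric_isMetric.Build R (set_type A)
  sub_mdist_ge0 sub_mdist_positivity sub_ballEmdist.

Lemma set_type_compact : compact A -> compact [set: A].
Proof.
move=> cA F PF _.
have [|p [Ap clp]] := cA ((@set_val X A) @ F) _.
  apply: (@filterS _ F _ setT); last exact: filterT.
  by move=> x _ /=; exact: set_valP.
exists (exist _ p (mem_set Ap)); split => // U V FU.
rewrite -nbhs_ballE => -[e /= e0 eV].
have FU' : ((@set_val X A) @ F) (@set_val X A @` U).
  by apply: (@filterS _ F _ U) FU; exact: preimage_image.
have [_ [[y Uy <-] py]] := clp _ _ FU' (nbhsx_ballx p e e0).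
exists y; split => //; apply: eV.
by move: py; rewrite set_valE.
Qed.

End subspace_metric.

Section lipschitz_distance.
Context {R : realType}.
Implicit Types X Y Z : metricType R.

(* The library's [lipschitz] is only available on normed modules. *)
Definition mlipschitz X Y (f : X -> Y) : Prop :=
  exists k : R, forall x y, mdist (f x) (f y) <= k * mdist x y.

(* [sup] is only meaningful on bounded sets, so [dil f] is the dilation of [f]
   for [f] Lipschitz.  If [X] has at most one point the set is empty, and
   [dil f = 0], [ln (dil f) = 0]: such spaces are at distance 0 from
   themselves. *)
Definition dil X Y (f : X -> Y) : R :=
  sup [set mdist (f p.1) (f p.2) / mdist p.1 p.2
      | p in [set p : X * X | p.1 <> p.2]].

Definition eps_isometry X Y (e : R) (f : X -> Y) : Prop :=
  exists g : Y -> X, [/\ cancel f g, cancel g f, mlipschitz f, mlipschitz g &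
    `|ln (dil f)| + `|ln (dil g)| <= e].

Definition dL X Y : \bar R :=
  ereal_inf [set e%:E
            | e in [set e : R | 0 <= e /\ exists f : X -> Y, eps_isometry e f]].

Definition isometric X Y : Prop :=
  exists2 f : X -> Y, bijective f & forall x y, mdist (f x) (f y) = mdist x y.

Lemma isometric_refl X : isometric X X.
Proof. by exists idfun => //; exists idfun. Qed.

Lemma isometric_sym X Y : isometric X Y -> isometric Y X.
Proof.
move=> [f [g fK gK] fd]; exists g; first by exists f.
by move=> x y; rewrite -fd !gK.
Qed.

Lemma isometric_trans X Y Z : isometric X Y -> isometric Y Z -> isometric X Z.
Proof.
move=> [f fb fd] [g gb gd]; exists (g \o f); first exact: bij_comp.
by move=> x y; rewrite /= gd fd.
Qed.

Lemma dil_isor X Y Z (f : X -> Y) (h : Y -> Z) :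
  (forall x y, mdist (h x) (h y) = mdist x y) -> dil (h \o f) = dil f.
Proof. by move=> hd; rewrite /dil; under eq_imagel do rewrite /= hd. Qed.

Lemma dil_isol X Y Z (h : X -> Y) (f : Y -> Z) : bijective h ->
  (forall x y, mdist (h x) (h y) = mdist x y) -> dil (f \o h) = dil f.
Proof.
move=> [k hK kK] hd; rewrite /dil; congr sup; apply/seteqP; split => _ [p/= pn <-].
  exists (h p.1, h p.2) => /=; last by rewrite hd.
  by move=> /(congr1 k); rewrite !hK.
exists (k p.1, k p.2) => /=; last by rewrite -hd !kK.
by move=> /(congr1 h); rewrite !kK.
Qed.

Lemma dL_isol X Y Z : isometric X Y -> (dL X Z <= dL Y Z)%E.
Proof.
move=> [h hb hd]; apply: ereal_inf_le_tmp => _ [e [e0 [f [g [fK gK fl gl efg]]]] <-].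
exists e => //; split => //; have [k hK kK] := hb.
have kd x y : mdist (k x) (k y) = mdist x y by rewrite -hd !kK.
exists (f \o h), (k \o g); split.
- exact: can_comp.
- exact: can_comp.
- by have [c cf] := fl; exists c => x y /=; rewrite (le_trans (cf _ _))// hd.
- by have [c cg] := gl; exists c => x y /=; rewrite kd cg.
- by rewrite dil_isol// dil_isor.
Qed.

Lemma dL_sym X Y : dL X Y = dL Y X.
Proof.
rewrite /dL; congr (ereal_inf _); apply/seteqP.
by split => _ [e [e0 [f [g [? ? ? ? efg]]]] <-]; exists e => //; split => //;
  exists g, f; split; rewrite // addrC.
Qed.

Lemma dL_isometric X X' Y Y' :
  isometric X X' -> isometric Y Y' -> dL X Y = dL X' Y'.
Proof.
have dLl X1 X2 Z : isometric X1 X2 -> dL X1 Z = dL X2 Z.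
  by move=> i; apply/eqP; rewrite eq_le !dL_isol//; exact: isometric_sym.
by move=> iX iY; rewrite (dLl _ _ _ iX) dL_sym (dLl _ _ _ iY) dL_sym.
Qed.

End lipschitz_distance.

Record cmspace (R : realType) := CMSpace {
  cms_sort :> metricType R ;
  cms_compact : compact [set: cms_sort] }.

Section isometry_classes.
Variable R : realType.

(* [cmspace R] lives in too large a universe for [choiceType], hence for the
   library's quotients, and for [set] and [countable]; isometry classes are thus
   plain predicates on spaces. *)
Record isoclass := IsoClass {
  isoclass_pred :> cmspace R -> Prop ;
  isoclassP : exists X : cmspace R, isoclass_pred = (fun Y => isometric X Y) }.

Definition isoclass_of (X : cmspace R) : isoclass :=
  IsoClass (ex_intro _ X erefl).

Definition isoclass_repr (C : isoclass) : cmspace R := sval (cid (isoclassP C)).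

Lemma isoclass_eqP (X Y : cmspace R) :
  isoclass_of X = isoclass_of Y <-> isometric X Y.
Proof.
split=> [XY|XY].
  have : isoclass_of Y Y by exact: isometric_refl.
  by rewrite -XY.
rewrite /isoclass_of; move: (ex_intro _ X _) (ex_intro _ Y _).
suff -> : (fun Z : cmspace R => isometric X Z) = (fun Z => isometric Y Z).
  by move=> p q; congr IsoClass; exact: Prop_irrelevance.
apply/funext => Z; apply/propext; split; last exact: isometric_trans.
by apply: isometric_trans; exact: isometric_sym.
Qed.

Lemma isoclass_reprK (C : isoclass) : isoclass_of (isoclass_repr C) = C.
Proof.
rewrite /isoclass_repr /isoclass_of; case: cid => X /=.
case: C => C CP /= CX; move: CP CX (ex_intro _ X _) => /[swap] -> p q.
by congr IsoClass; exact: Prop_irrelevance.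
Qed.

Definition dL_class (C D : isoclass) : \bar R :=
  dL (isoclass_repr C) (isoclass_repr D).

Lemma dL_classE (X Y : cmspace R) :
  dL_class (isoclass_of X) (isoclass_of Y) = dL X Y.
Proof. by apply: dL_isometric; apply/isoclass_eqP; rewrite isoclass_reprK. Qed.

Lemma unit_segment_compact : compact (`[0, 1]%classic : set R^o).
Proof. exact: segment_compact. Qed.

Definition unit_interval : cmspace R :=
  CMSpace (set_type_compact unit_segment_compact).

Lemma unit_intervalE (x y : unit_interval) :
  mdist x y = `|\val x - \val y|.
Proof. exact: distrC. Qed.

Definition M01 (C : isoclass) : Prop :=
  (dL_class (isoclass_of unit_interval) C < +oo)%E.

End isometry_classes.

(* [M], a subset of a type with distance [d], has a countable dense subset. *)
Definition separable_subset (R : realType) (T : Type) (d : T -> T -> \bar R)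
    (M : T -> Prop) : Prop :=
  exists D : T -> Prop, [/\ forall x, D x -> M x,
    exists f : T -> nat, forall x y, D x -> D y -> f x = f y -> x = y &
    forall x, M x -> forall e : R, 0 < e -> exists2 y, D y & (d x y < e%:E)%E].

(* Main.v *)
(* For a set A of naturals, let h be the function on [0, 1] whose graph has a
   tent of slope 2 over each point p_n = 8^-n / 2 with n in A, and let Y_A be
   [0, 1] with the distance max (|x - y|, |h x - h y|), which is bi-Lipschitz to
   the Euclidean one.  At a peak p_n there are arbitrarily small equilateral
   triangles (p_n, p_n - t, p_n + t), while at a point near which h is monotone,
   i.e. at any point other than 0 and the peaks, small triangles are far from
   equilateral.  Hence a map Y_A -> Y_B distorting distances by at most 11/10
   sends peaks to peaks or to 0; for A infinite, the distances between peaks,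
   which are comparable to the larger of the two points, then force it to fix
   every peak of A, so that A is a subset of B.  Coding boolean sequences by
   pairwise incomparable infinite sets A gives uncountably many spaces that are
   uniformly separated for the Lipschitz distance. *)
Require Import Defs.
From HB Require Import structures.
From mathcomp Require Import all_boot all_order all_algebra.
From mathcomp Require Import all_classical all_reals all_analysis.
From mathcomp Require Import ring lra zify.

Set Implicit Arguments.
Unset Strict Implicit.
Unset Printing Implicit Defensive.

Import Order.TTheory GRing.Theory Num.Theory.
Import numFieldNormedType.Exports.

Local Open Scope classical_set_scope.
Local Open Scope ring_scope.

(* The graph of [h] in the product of [X] and the line, with the maximum distance. *)
Definition graph_space (R : realType) (X : metricType R) (h : X -> R) : Type := X.

(** * The maximum metric on a graph *)

Section graph_metric.
Context {R : realType} {X : metricType R} (h : X -> R).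

(** Only the choice structure of [X] is kept; the topology is the one induced by the new metric. *)
HB.instance Definition _ := Choice.copy (graph_space h) X.

Definition graph_mdist (x y : graph_space h) : R :=
  Num.max (@mdist R X x y) `|h x - h y|.

Lemma graph_mdistxx x : graph_mdist x x = 0.
Proof. by rewrite /graph_mdist mdistxx subrr normr0 maxxx. Qed.

Lemma graph_mdist_positivity x y : graph_mdist x y = 0 -> x = y.
Proof.
move=> xy0; apply: (@mdist_positivity R X); apply/eqP.
by rewrite eq_le mdist_ge0 andbT -[leRHS]xy0 le_max lexx.
Qed.

Lemma graph_mdist_sym x y : graph_mdist x y = graph_mdist y x.
Proof. by rewrite /graph_mdist metric_sym distrC. Qed.

Lemma graph_mdist_triangle y x z :
  graph_mdist x z <= graph_mdist x y + graph_mdist y z.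
Proof.
rewrite /graph_mdist ge_max; apply/andP; split.
  by rewrite (le_trans (metric_triangle x y z))// lerD// le_max lexx.
by rewrite (le_trans (ler_distD (h y) _ _))// lerD// le_max lexx orbT.
Qed.

HB.instance Definition _ := isMetric.Build R (graph_space h)
  graph_mdistxx graph_mdist_positivity graph_mdist_sym graph_mdist_triangle.

Lemma graph_mdistE (x y : graph_space h) :
  mdist x y = Num.max (@mdist R X x y) `|h x - h y|.
Proof. by []. Qed.

End graph_metric.

(** * Lipschitz maps, dilation and Lipschitz distance *)

Section lipschitz.
Context {R : realType}.
Implicit Types X Y Z : metricType R.

Lemma mlipschitz_continuous X Y (f : X -> Y) : mlipschitz f -> continuous f.
Proof.
move=> [k fk] x; apply/metricType_numDomainType.cvgrPdist_lt => e e0.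
(* [k] may be zero or negative, hence the substitute [|k| + 1]. *)
have k0 : 0 < `|k| + 1 by rewrite ltr_wpDl.
apply/metricType_numDomainType.nbhs_mdistP; exists (e / (`|k| + 1)).
  exact: divr_gt0.
move=> y /=; rewrite ltr_pdivlMr// => xy.
apply: le_lt_trans xy; rewrite mulrC (le_trans (fk _ _))// ler_wpM2r ?mdist_ge0//.
by rewrite (le_trans (ler_norm k))// lerDl.
Qed.

Lemma mlipschitz_compact X Y (f : X -> Y) : mlipschitz f ->
  (forall y, exists x, f x = y) -> compact [set: X] -> compact [set: Y].
Proof.
move=> lf fs cX; have -> : [set: Y] = f @` [set: X].
  by apply/seteqP; split => // y _; have [x <-] := fs y; exists x.
apply: continuous_compact => //.
exact/continuous_subspaceT/mlipschitz_continuous.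
Qed.

Lemma dil_mlipschitz X Y (f : X -> Y) : mlipschitz f ->
  forall x y, mdist (f x) (f y) <= dil f * mdist x y.
Proof.
move=> [k fk] x y; have [->|/eqP xy] := eqVneq x y.
  by rewrite !mdistxx mulr0.
have gt0 p q : p <> q -> 0 < mdist p q :> R.
  by move=> pq; rewrite mdist_gt0; exact/eqP.
rewrite -ler_pdivrMr ?gt0//; apply: ub_le_sup; last by exists (x, y).
by exists k => _ [[p q] /= pq <-]; rewrite ler_pdivrMr ?gt0.
Qed.

(** A single constant serves both directions, so that constants multiply under composition. *)
Definition distorts (c : R) X Y (f : X -> Y) : Prop :=
  forall x y, mdist (f x) (f y) <= c * mdist x y /\
              mdist x y <= c * mdist (f x) (f y).

Lemma distorts_comp X Y Z (c d : R) (f : X -> Y) (g : Y -> Z) :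
  0 <= c -> 0 <= d -> distorts c f -> distorts d g -> distorts (c * d) (g \o f).
Proof.
move=> c0 d0 cf dg x y; have [f1 f2] := cf x y; have [g1 g2] := dg (f x) (f y).
split => /=; last by rewrite (le_trans f2)// -mulrA ler_wpM2l.
by rewrite (le_trans g1)// [c * d]mulrC -mulrA ler_wpM2l.
Qed.

Lemma dil_le_expR X Y (f : X -> Y) (e : R) : `|ln (dil f)| <= e -> dil f <= expR e.
Proof.
move=> fe; have [d0|d0] := ltP 0 (dil f); last exact: le_trans (expR_ge0 e).
by rewrite -[leLHS]lnK ?posrE// ler_expR (le_trans _ fe)// ler_norm.
Qed.

(** Each logarithm is at most their sum, so [f] and its inverse are both Lipschitz with constant
    [expR e]; the bound for the inverse is the lower bound for [f]. *)
Lemma dL_lt_distorts X Y (e : R) : (dL X Y < e%:E)%E ->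
  exists f : X -> Y, distorts (expR e) f.
Proof.
move=> /ereal_inf_lt[_ [d [d0 [f [g [fK gK lf lg fgd]]]] <-]]; rewrite lte_fin => de.
exists f => x y.
have le_dil (U V : metricType R) (h : U -> V) : mlipschitz h -> `|ln (dil h)| <= e ->
    forall u v, mdist (h u) (h v) <= expR e * mdist u v.
  move=> lh he u v; rewrite (le_trans (dil_mlipschitz lh _ _))//.
  by rewrite ler_wpM2r ?mdist_ge0// dil_le_expR.
have := normr_ge0 (ln (dil f)); have := normr_ge0 (ln (dil g)) => ? ?.
split; first by apply: le_dil => //; lra.
by rewrite -{1}(fK x) -{1}(fK y); apply: le_dil => //; lra.
Qed.

Lemma dL_lty X Y (f : X -> Y) (g : Y -> X) : cancel f g -> cancel g f ->
  mlipschitz f -> mlipschitz g -> (dL X Y < +oo)%E.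
Proof.
move=> fK gK lf lg; apply: le_lt_trans (ltry (`|ln (dil f)| + `|ln (dil g)|)).
apply: ereal_inf_lbound; exists (`|ln (dil f)| + `|ln (dil g)|) => //.
by split; [rewrite addr_ge0|exists f, g; split].
Qed.

End lipschitz.

(** * Nearly equilateral triangles in a graph *)

Section graph_distance.
Context {R : realType}.
Implicit Types (h : R -> R) (x y d : R).

Definition gdist h x y : R := Num.max `|x - y| `|h x - h y|.

Lemma gdistC h x y : gdist h x y = gdist h y x.
Proof. by rewrite /gdist distrC [X in Num.max _ X]distrC. Qed.

Lemma gdistN h x y : gdist (fun z => - h z) x y = gdist h x y.
Proof. by rewrite /gdist -opprD normrN. Qed.

(** A triangle with all sides [close] to one [d] is nearly equilateral; 11/10 is the distortion
    allowed to maps later. *)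
Definition close (d e : R) := d <= 11/10 * e /\ e <= 11/10 * d.

Definition monotone_near h y := exists2 r : R, 0 < r &
  (forall u v, `|u - y| < r -> `|v - y| < r -> u <= v -> h u <= h v) \/
  (forall u v, `|u - y| < r -> `|v - y| < r -> u <= v -> h v <= h u).

(* If both [gdist h p q] and [gdist h q s] are at least [d], then
   [gdist h p s >= 3/2 * d]: in the worst case one of them is a difference of
   abscissae and the other one of heights, the latter spanning at least [d / 2]
   on the axis. *)
Lemma increasing_not_equilateral h p q s d : 0 < d ->
  (forall u v, `|h u - h v| <= 2 * `|u - v|) ->
  p <= q -> q <= s -> h p <= h q -> h q <= h s ->
  close d (gdist h p q) -> close d (gdist h q s) -> close d (gdist h p s) ->
  False.
Proof.
move=> d0 h2 pq qs hpq hqs.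
have gE u v : u <= v -> h u <= h v -> gdist h u v = Num.max (v - u) (h v - h u).
  by move=> uv huv; rewrite gdistC /gdist !ger0_norm ?subr_ge0.
have li u v : u <= v -> h u <= h v -> h v - h u <= 2 * (v - u).
  by move=> uv huv; rewrite -[v - u]ger0_norm ?subr_ge0// (le_trans (ler_norm _)).
have := li _ _ pq hpq; have := li _ _ qs hqs.
rewrite !gE ?(le_trans pq)// ?(le_trans hpq)// /close [in _ /\ Num.max (s - p) _ <= _]ge_max.
move=> qs2 pq2 [+ _] [+ _] [_ /andP[+ +]].
by case: (leP (q - p)) => _; case: (leP (s - q)) => _; lra.
Qed.

(** The three closeness conditions are symmetric in the three points, so the points can be sorted,
    wherever [y] lies among them. *)
Lemma monotone_near_not_equilateral h y :
  (forall u v, `|h u - h v| <= 2 * `|u - v|) -> monotone_near h y ->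
  exists2 r : R, 0 < r & forall u v d, 0 < d -> `|u - y| < r -> `|v - y| < r ->
    close d (gdist h y u) -> close d (gdist h y v) -> close d (gdist h u v) ->
    False.
Proof.
move=> h2 [r r0 hmono]; exists r => // u v d d0 ur vr.
have yr : `|y - y| < r by rewrite subrr normr0.
have sorted_case p q s : `|p - y| < r -> `|q - y| < r -> `|s - y| < r ->
    p <= q -> q <= s ->
    close d (gdist h p q) -> close d (gdist h q s) -> close d (gdist h p s) ->
    False.
  move=> pr qr sr pq qs; case: hmono => mono.
    exact: increasing_not_equilateral d0 h2 pq qs (mono _ _ _ _ pq) (mono _ _ _ _ qs).
  (* Passing to [- h] preserves [gdist] and turns the decreasing case into the increasing one. *)
  rewrite -!(gdistN h); apply: increasing_not_equilateral => //.
  - by move=> p' q'; rewrite -opprD normrN.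
  - by rewrite lerN2 mono.
  - by rewrite lerN2 mono.
wlog uv : u v ur vr / u <= v => [hw yu yv uv|yu yv uv'].
  have [|/ltW] := leP u v => [|vu]; first by move/hw; apply.
  by apply: (hw v u) => //; rewrite gdistC.
have [yu'|/ltW uy] := leP y u; first exact: (sorted_case y u v).
have [yv'|/ltW vy] := leP y v.
  by apply: (sorted_case u y v) => //; rewrite gdistC.
by apply: (sorted_case u v y) => //; rewrite gdistC.
Qed.

End graph_distance.

(** * Tents over a geometric sequence of peaks *)

Section tents.
Context {R : realType}.
Implicit Types (A B : nat -> bool) (x y t : R).

Definition peak n : R := 2^-1 * 8^-1 ^+ n.

Definition tent n x : R := Num.max 0 (2 * (peak n / 8 - `|x - peak n|)).

Definition tent_if A n x : R := if A n then tent n x else 0.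

(** At most one term is nonzero at each [x], so this is also the sum of the tents; as a supremum it
    inherits the Lipschitz constant 2 termwise. *)
Definition tents A x : R := sup (range (tent_if A ^~ x)).

Lemma peak_gt0 n : 0 < peak n.
Proof. by rewrite mulr_gt0// exprn_gt0. Qed.

Lemma peakS n : peak n.+1 = peak n / 8.
Proof. by rewrite /peak exprS; field. Qed.

Lemma peak_le m n : (m <= n)%N -> peak n <= peak m.
Proof.
by move=> mn; rewrite ler_wpM2l// ler_wiXn2l//; lra.
Qed.

Lemma peak_lt m n : (m < n)%N -> peak n <= peak m / 8.
Proof. by rewrite -peakS; exact: peak_le. Qed.

Lemma peak_le2 n : peak n <= 2^-1.
Proof. by rewrite (le_trans (peak_le (leq0n n)))// /peak expr0 mulr1. Qed.

Lemma tent_ge0 n x : 0 <= tent n x.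
Proof. by rewrite le_max lexx. Qed.

Lemma tent_le1 n x : tent n x <= 1.
Proof.
rewrite ge_max ler01 /=; have := peak_le2 n; have := normr_ge0 (x - peak n); lra.
Qed.

Lemma tent_eq0 n x : peak n / 8 <= `|x - peak n| -> tent n x = 0.
Proof. by move=> ?; apply/max_idPl; lra. Qed.

Lemma tentE n x : `|x - peak n| <= peak n / 8 ->
  tent n x = 2 * (peak n / 8 - `|x - peak n|).
Proof. by move=> ?; apply/max_idPr; lra. Qed.

Lemma tent_lipschitz n x y : tent n x <= tent n y + 2 * `|x - y|.
Proof.
rewrite {1}/tent ge_max; apply/andP; split.
  by rewrite addr_ge0 ?tent_ge0// mulr_ge0.
have : 2 * (peak n / 8 - `|y - peak n|) <= tent n y by rewrite le_max lexx orbT.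
have := ler_distD x y (peak n); rewrite (distrC y x); lra.
Qed.

Lemma tent_lel n x y : x <= y -> y <= peak n -> tent n x <= tent n y.
Proof.
move=> xy yn; rewrite /tent ge_max !le_max lexx/=; apply/orP; right.
by rewrite !ler0_norm; lra.
Qed.

Lemma tent_ler n x y : x <= y -> peak n <= x -> tent n y <= tent n x.
Proof.
move=> xy yn; rewrite /tent ge_max !le_max lexx/=; apply/orP; right.
by rewrite !ger0_norm; lra.
Qed.

Lemma tent_if_ge0 A n x : 0 <= tent_if A n x.
Proof. by rewrite /tent_if; case: ifP => // _; exact: tent_ge0. Qed.

Lemma tent_if_le1 A n x : tent_if A n x <= 1.
Proof. by rewrite /tent_if; case: ifP => // _; exact: tent_le1. Qed.

Lemma tent_if_le_tents A n x : tent_if A n x <= tents A x.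
Proof.
apply: ub_le_sup; last by exists n.
by exists 1 => _ [m _ <-]; exact: tent_if_le1.
Qed.

Lemma tents_le A x t : (forall n, tent_if A n x <= t) -> tents A x <= t.
Proof.
move=> At; apply: ge_sup; first by exists (tent_if A 0 x), 0%N.
by move=> _ [n _ <-].
Qed.

Lemma tents_lipschitz A x y : `|tents A x - tents A y| <= 2 * `|x - y|.
Proof.
have le u v : tents A u <= tents A v + 2 * `|u - v|.
  apply: tents_le => n; rewrite (@le_trans _ _ (tent_if A n v + 2 * `|u - v|))//.
    rewrite /tent_if; case: ifP => _; first exact: tent_lipschitz.
    by rewrite add0r mulr_ge0.
  by rewrite lerD2r tent_if_le_tents.
have := le x y; have := le y x; rewrite (distrC y x) ler_norml => ? ?.
by apply/andP; split; lra.
Qed.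

(** Tent [m] lives on [[7/8 * peak m, 9/8 * peak m]]: for [m < n] this starts at or above
    [7 * peak n], for [m > n] it ends at or below [9/64 * peak n < peak n / 6]. *)
Lemma tents_local A n x : peak n / 6 < x -> x < 3 * peak n ->
  tents A x = tent_if A n x.
Proof.
move=> nx xn; apply/eqP; rewrite eq_le tent_if_le_tents andbT.
apply: tents_le => m; have [->//|mn] := eqVneq m n.
suff tm0 : tent m x = 0 by rewrite {1}/tent_if tm0 if_same tent_if_ge0.
have := peak_gt0 n; have := peak_gt0 m => m0 n0.
apply: tent_eq0; move: mn; rewrite neq_ltn => /orP[/peak_lt|/peak_lt] mn.
  by rewrite ler0_norm; lra.
by rewrite ger0_norm; lra.
Qed.

(** For the least [n] with [peak n / 6 < y], minimality gives [y <= 8/6 * peak n] when [n > 0]; for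
    [n = 0], [y <= 1 < 3/2]. *)
Lemma peak_tile y : 0 < y -> y <= 1 -> exists n, peak n / 6 < y /\ y < 3 * peak n.
Proof.
move=> y0 y1.
have ex : exists n, peak n / 6 < y.
  have : (geometric (2^-1 / 6) (8^-1) : R^nat) @ \oo --> (0 : R).
    by apply: cvg_geometric; rewrite ger0_norm; lra.
  move=> /cvgrPdist_lt/(_ _ y0)[N _ /(_ N (leqnn N))] /= h; exists N.
  apply: le_lt_trans h; rewrite sub0r normrN.
  by apply: le_trans (ler_norm _); rewrite /peak; lra.
have [n ny nmin] := ex_minnP ex; exists n; split => //.
case: n ny nmin => [|n] ny nmin; first by rewrite /peak expr0; lra.
have : ~~ (peak n / 6 < y) by apply/negP => /nmin; rewrite ltnn.
rewrite -leNgt peakS; have := peak_gt0 n; lra.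
Qed.

Lemma tents_monotone_near A y : 0 < y -> y <= 1 ->
  (forall n, A n -> y <> peak n) -> monotone_near (tents A) y.
Proof.
move=> y0 y1 yA; have [n [ny yn]] := peak_tile y0 y1.
(* Radius [s] stays inside the window where only tent [n] can be nonzero. *)
pose s := Num.min (y - peak n / 6) (3 * peak n - y).
have s0 : 0 < s by rewrite lt_min; apply/andP; split; lra.
have tE u : `|u - y| < s -> tents A u = tent_if A n u.
  by rewrite lt_min !ltr_norml => us; apply: tents_local; lra.
have [An|An] := boolP (A n); last first.
  exists s => //; left => u v us vs uv.
  by rewrite !tE// /tent_if (negbTE An).
have tEt u : `|u - y| < s -> tents A u = tent n u.
  by move=> us; rewrite tE// /tent_if An.
have yp := yA _ An; have [ylt|ygt|] := ltgtP y (peak n); last by [].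
- exists (Num.min s (peak n - y)); first by rewrite lt_min s0; lra.
  left => u v; rewrite lt_min => /andP[us _]; rewrite lt_min => /andP[vs vp] uv.
  by rewrite !tEt// tent_lel//; move: vp; rewrite ltr_norml; lra.
- exists (Num.min s (y - peak n)); first by rewrite lt_min s0; lra.
  right => u v; rewrite lt_min => /andP[us up]; rewrite lt_min => /andP[vs _] uv.
  by rewrite !tEt// tent_ler//; move: up; rewrite ltr_norml; lra.
Qed.

Lemma tents_tent A n (x : R) : A n -> `|x - peak n| <= peak n / 8 ->
  tents A x = 2 * (peak n / 8 - `|x - peak n|).
Proof.
move=> An xn; rewrite -tentE// (@tents_local A n) /tent_if ?An//;
  by move: xn; rewrite ler_norml; have := peak_gt0 n; lra.
Qed.

(** A step [t] off the peak lowers the height by [2 * t], which dominates the abscissa; the two side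
    points have equal height and abscissae [2 * t] apart. *)
Lemma gdist_peak A n (t : R) : A n -> 0 <= t <= peak n / 8 ->
  [/\ gdist (tents A) (peak n) (peak n - t) = 2 * t,
      gdist (tents A) (peak n) (peak n + t) = 2 * t &
      gdist (tents A) (peak n - t) (peak n + t) = 2 * t].
Proof.
move=> An /andP[t0 tn]; have t2 : 0 <= 2 * t by rewrite mulr_ge0.
have n0 := peak_gt0 n.
have tp : tents A (peak n) = peak n / 4 :> R.
  by rewrite (@tents_tent A n)// subrr normr0; lra.
have tl : tents A (peak n - t) = peak n / 4 - 2 * t.
  by rewrite (@tents_tent A n)// addrAC subrr add0r normrN ger0_norm; lra.
have tr : tents A (peak n + t) = peak n / 4 - 2 * t.
  by rewrite (@tents_tent A n)// addrAC subrr add0r ger0_norm; lra.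
rewrite /gdist tp tl tr; split.
- by rewrite !subKr !ger0_norm// max_r//; lra.
- by rewrite subKr opprD addrA subrr add0r normrN !ger0_norm// max_r//; lra.
- rewrite subrr normr0 opprD addrACA subrr add0r -opprD normrN ger0_norm ?addr_ge0//.
  by rewrite max_l ?addr_ge0//; lra.
Qed.

(** Distinct points among 0 and the peaks are at a distance between 7/8 of the larger one and the
    larger one itself. The bounds thus place the larger point within a factor less than 8 of
    [peak n], so it is [peak n]. *)
Lemma peak_near n (z w : R) :
  (z = 0 \/ exists m, z = peak m) -> (w = 0 \/ exists m, w = peak m) ->
  7/8 * peak n <= 22/10 * `|z - w| -> `|z - w| <= 22/10 * peak n ->
  z = peak n \/ w = peak n.
Proof.
wlog wz : z w / w <= z => [hw|].
  have [/hw//|/ltW zw hz hw'] := leP w z; rewrite distrC => h1 h2.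
  by case: (hw _ _ zw hw' hz h1 h2); [right|left].
rewrite ger0_norm ?subr_ge0// => hz hw h1 h2; left.
have n0 := peak_gt0 n.
case: hz => [z0|[k zk]].
  have w0 : 0 <= w by case: hw => [->//|[m ->]]; exact/ltW/peak_gt0.
  lra.
have w0 : 0 <= w by case: hw => [->//|[m ->]]; exact/ltW/peak_gt0.
rewrite zk; have [kn|kn|->//] := ltngtP k n; last first.
  by have := peak_lt kn; lra.
have := peak_lt kn => nk.
have wk : w <= peak k / 8.
  case: hw => [w00|[m wm]]; first by lra.
  rewrite wm; apply: peak_lt; rewrite ltnNge; apply/negP => mk.
  by have := peak_le mk; lra.
lra.
Qed.

(* If [z n <> peak n], then [peak_near] forces [z m = peak n] for all larger [m],
   whereas [z] is injective. *)
Lemma peaks_rigid A B (z : nat -> R) :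
  (forall n, A n -> z n = 0 \/ exists2 m, B m & z n = peak m) ->
  (forall m n, A m -> A n -> `|peak m - peak n| <= 22/10 * `|z m - z n| /\
                           `|z m - z n| <= 22/10 * `|peak m - peak n|) ->
  (forall n, exists2 m, (n < m)%N & A m) -> forall n, A n -> B n.
Proof.
move=> zB zd Ainf n An.
have [m nm Am] := Ainf n; have [k mk Ak] := Ainf m.
have n0 := peak_gt0 n; have m0 := peak_gt0 m; have k0 := peak_gt0 k.
have npeak l : A l -> (n < l)%N -> z n = peak n \/ z l = peak n.
  move=> Al nl; have l0 := peak_gt0 l; have nl' := peak_lt nl.
  have peaks i : A i -> z i = 0 \/ exists m, z i = peak m.
    by move=> /zB[->|[j _ ->]]; [left|right; exists j].
  have [] := zd _ _ An Al; rewrite [`|peak n - _|]ger0_norm; last by lra.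
  by move=> ? ?; apply: peak_near (peaks _ An) (peaks _ Al) _ _; lra.
have zn : z n = peak n.
  have [//|zm] := npeak m Am nm.
  have [//|zk] := npeak k Ak (ltn_trans nm mk).
  have [] := zd _ _ Am Ak; have km := peak_lt mk.
  by rewrite zm zk subrr normr0 ger0_norm; lra.
have [zn0|[i Bi zni]] := zB n An; first by lra.
have i0 := peak_gt0 i; have ni : peak n = peak i :> R by rewrite -zn.
have [->//|] := eqVneq n i.
by rewrite neq_ltn => /orP[/peak_lt|/peak_lt]; lra.
Qed.

End tents.

(** * The tented intervals and their maps of small distortion *)

Section tented_interval.
Context {R : realType}.
Implicit Types (A B : nat -> bool).

Definition height A (x : unit_interval R) : R := tents A (\val x).

Definition tented A : metricType R := graph_space (height A).

Lemma tented_mdistE A (x y : tented A) :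
  mdist x y = gdist (tents A) (\val x) (\val y).
Proof. by rewrite graph_mdistE unit_intervalE. Qed.

Lemma tented_mdist_ge A (x y : tented A) : `|\val x - \val y| <= mdist x y.
Proof. by rewrite tented_mdistE le_max lexx. Qed.

Lemma tented_mdist_le A (x y : tented A) : mdist x y <= 2 * `|\val x - \val y|.
Proof.
rewrite tented_mdistE ge_max tents_lipschitz andbT.
by have := normr_ge0 (\val x - \val y); lra.
Qed.

Definition to_tented A (x : unit_interval R) : tented A := x.

Definition of_tented A (x : tented A) : unit_interval R := x.

Lemma to_tented_mlipschitz A : mlipschitz (@to_tented A).
Proof. by exists 2 => x y; rewrite unit_intervalE tented_mdist_le. Qed.

Lemma of_tented_mlipschitz A : mlipschitz (@of_tented A).
Proof. by exists 1 => x y; rewrite unit_intervalE mul1r tented_mdist_ge. Qed.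

Lemma tented_compact A : compact [set: tented A].
Proof.
apply: (mlipschitz_compact (to_tented_mlipschitz A)).
  by move=> y; exists y.
exact: cms_compact.
Qed.

Definition tented_cms A : cmspace R := CMSpace (@tented_compact A).

Lemma tented_M01 A : M01 (isoclass_of (tented_cms A)).
Proof.
rewrite /M01 dL_classE.
exact: (dL_lty _ _ (to_tented_mlipschitz A) (of_tented_mlipschitz A)).
Qed.

Lemma tented_range A (x : tented A) : 0 <= \val x <= 1.
Proof. by have := valP x; rewrite inE /= in_itv. Qed.

Lemma tented_point A (t : R) : 0 <= t <= 1 -> exists x : tented A, \val x = t.
Proof.
move=> t01; have tI : t \in (`[0, 1]%classic : set R^o) by rewrite inE /= in_itv.
by exists (exist _ t tI).
Qed.

Lemma tented_peak A n : exists x : tented A, \val x = peak n :> R.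
Proof.
apply: tented_point; rewrite ltW ?peak_gt0//=.
by have := @peak_le2 R n; lra.
Qed.

(** Small equilateral triangles at the peak [p] are sent to small, nearly equilateral triangles at
    [f p], which cannot exist where [tents B] is monotone. *)
Lemma distorts_peak A B (f : tented A -> tented B) n (p : tented A) :
  distorts (11/10) f -> A n -> \val p = peak n ->
  \val (f p) = 0 \/ exists2 m, B m & \val (f p) = peak m.
Proof.
move=> fd An pn; set y : R := \val (f p).
have [y0|y0] := eqVneq y 0; first by left.
have [[m Bm ym]|yB] := pselect (exists2 m, B m & y = peak m).
  by right; exists m.
exfalso; have /andP[ge0y y1] : 0 <= y <= 1 by exact: tented_range.
have [||r r0 noeq] := @monotone_near_not_equilateral R (tents B) y.
- exact: tents_lipschitz.
- apply: tents_monotone_near => //; first by rewrite lt_neqAle eq_sym y0.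
  by move=> m Bm ym; apply: yB; exists m.
have n0 := @peak_gt0 R n; have n1 := @peak_le2 R n.
have [t [t0 tn tr]] : exists t : R, [/\ 0 < t, t <= peak n / 8 & 11/10 * (2 * t) < r].
  (* The first bound keeps the triangle on the tent, the second keeps its image within [r] of
     [y]. *)
  exists (Num.min (peak n / 8) (r / 4)).
  rewrite lt_min ge_min lexx; split => //; first by apply/andP; split; lra.
  have : Num.min (peak n / 8) (r / 4) <= r / 4 by rewrite ge_min lexx orbT.
  by move: (Num.min _ _) => t; lra.
have [|d1 d2 d3] := @gdist_peak R _ _ t An; first by rewrite ltW.
have [|a an] := @tented_point A (peak n - t); first by apply/andP; split; lra.
have [|b bn] := @tented_point A (peak n + t); first by apply/andP; split; lra.
have [] := fd p a; rewrite !tented_mdistE pn an d1 -/y => ya1 ya2.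
have [] := fd p b; rewrite !tented_mdistE pn bn d2 -/y => yb1 yb2.
have [] := fd a b; rewrite !tented_mdistE an bn d3 => ab1 ab2.
have near x : mdist (f p) (f x) <= 11/10 * (2 * t) -> `|\val (f x) - y| < r.
  move=> px; rewrite distrC.
  apply: le_lt_trans (tented_mdist_ge (f p) (f x)) _; exact: le_lt_trans px tr.
by apply: (noeq _ _ (2 * t) _ (near a _) (near b _)) => //;
  rewrite ?tented_mdistE ?mulr_gt0.
Qed.

(** The tented and Euclidean distances differ by a factor at most 2, so the coordinates of the peaks
    are distorted by at most 22/10 and [peaks_rigid] applies. *)
Lemma distorts_sub A B (f : tented A -> tented B) : distorts (11/10) f ->
  (forall n, exists2 m, (n < m)%N & A m) -> forall n, A n -> B n.
Proof.
move=> fd; pose q n : tented A := sval (cid (tented_peak A n)).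
have qE n : \val (q n) = peak n by rewrite /q; case: cid.
apply: (@peaks_rigid R A B (fun n => \val (f (q n)))) => [n An|m n _ _].
  exact: distorts_peak fd An (qE n).
have bound (a b c d : R) : a <= c -> c <= 2 * a -> b <= d -> d <= 2 * b ->
    d <= 11/10 * c /\ c <= 11/10 * d -> a <= 22/10 * b /\ b <= 22/10 * a.
  by move=> ? ? ? ? [? ?]; split; lra.
rewrite -!qE; exact: bound (tented_mdist_ge _ _) (tented_mdist_le _ _)
  (tented_mdist_ge _ _) (tented_mdist_le _ _) (fd (q m) (q n)).
Qed.

End tented_interval.

(* The set [{2 n + b n}] is infinite, and none of these sets contains another. *)
Definition coding (b : nat -> bool) (m : nat) : bool := odd m == b m./2.

Lemma coding_infinite b n : exists2 m, (n < m)%N & coding b m.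
Proof.
exists (b n.+1 + n.+1.*2)%N; first by rewrite -addnn; lia.
by rewrite /coding half_bit_double oddD odd_double addbF oddb.
Qed.

(** Each set contains exactly one of [2 n] and [2 n + 1], so one inclusion already forces equal
    choices. *)
Lemma coding_inj b c : (forall n, coding b n -> coding c n) -> b = c.
Proof.
move=> bc; apply/funext => n; have := bc (b n + n.*2)%N.
by rewrite /coding half_bit_double oddD odd_double addbF oddb eqxx => /(_ isT)/eqP.
Qed.

(** * Uncountability and the conclusion *)

Lemma no_injection_bool_seq_nat (G : (nat -> bool) -> nat) :
  ~ (forall b c, G b = G c -> b = c).
Proof.
(* Cantor's diagonal: by injectivity, [c] differs from each [b] at the place [G b], and [b := c] is
   absurd. *)
move=> Ginj; pose c n := `[< exists2 b, G b = n & ~~ b n >].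
have [/asboolP[b /Ginj -> /negP]//|] := boolP (c (G c)).
by move=> cc; move: (cc) => /asboolPn; apply; exists c.
Qed.

Theorem theorem3 (R : realType) : ~ separable_subset (@dL_class R) (@M01 R).
Proof.
move=> [D [_ [idx idx_inj] dense]].
(* Halved so that two maps of distortion [expR e] compose to distortion 11/10. *)
pose e : R := ln (11/10) / 2.
have e0 : 0 < e by rewrite divr_gt0// ln_gt0//; lra.
have ee : expR e * expR e = 11/10.
  by rewrite -expRD -splitr lnK// posrE; lra.
pose Y (b : nat -> bool) : cmspace R := tented_cms (coding b).
have near b : exists y, D y /\ (dL_class (isoclass_of (Y b)) y < e%:E)%E.
  by have [y] := dense _ (@tented_M01 R (coding b)) _ e0; exists y.
pose y b := sval (cid (near b)).
have yD b : D (y b) by rewrite /y; case: cid => ? [].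
have yY b : (dL (Y b) (isoclass_repr (y b)) < e%:E)%E.
  by rewrite -dL_classE isoclass_reprK /y; case: cid => ? [].
(* If [Y b] and [Y c] share their approximating class, going through it gives a map [Y b -> Y c] of
   distortion 11/10, hence an inclusion of codings and [b = c]. *)
apply: (@no_injection_bool_seq_nat (fun b => idx (y b))) => b c.
move=> /(idx_inj _ _ (yD b) (yD c)) ybc; apply: coding_inj.
have [f fe] := dL_lt_distorts (yY b).
have [g ge] : exists g : isoclass_repr (y b) -> Y c, distorts (expR e) g.
  by apply: dL_lt_distorts; rewrite ybc dL_sym.
have := distorts_comp (expR_ge0 e) (expR_ge0 e) fe ge; rewrite ee => gf.
exact: (@distorts_sub R _ _ (g \o f) gf (coding_infinite b)).
Qed.
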